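(* For every prime power $q$ and every $0<\varepsilon<1/2$ there exists a constant $c=c(q,\varepsilon)$ such that for every composite integer $n>c$, $$C_q(n)\le \frac{q^n}{n^{1/2-\varepsilon}}.$$
   Context: $\mathbb{F}_q$ is the finite field with $q$ elements. A finite ring $S$ is a Carmichael ring if $S$ is not a field and $a^{|S|}=a$ for every $a\in S$. A polynomial $f\in\mathbb{F}_q[t]$ is a Carmichael polynomial if $\mathbb{F}_q[t]/(f)$ is a Carmichael ring. $C_q(n)$ denotes the number of monic Carmichael polynomials in $\mathbb{F}_q[t]$ of degree $n$. *)

(* Defs.v *)
From HB Require Import structures.
From mathcomp Require Import all_boot all_order all_algebra.
Set Implicit Arguments. Unset Strict Implicit. Unset Printing Implicit Defensive.
Import GRing.Theory.
Local Open Scope ring_scope.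

(* A finite (commutative, unit) ring is a field iff every nonzero element is a
   unit (nontriviality 1 != 0 is part of the ring structure). *)
Definition is_field_ring (S : finComUnitRingType) : bool :=
  [forall x : S, (x != 0) ==> (x \is a GRing.unit)].

(* Declare the (already existing) finType structure of {poly %/ f} so that
   HB joins it with its comUnitRing structure into a finComUnitRingType. *)
HB.instance Definition _ (F : finFieldType) (f : {poly F}) :=
  Finite.on {poly %/ f}.

Definition carmichael_ring (S : finComUnitRingType) : bool :=
  ~~ is_field_ring S && [forall a : S, a ^+ #|S| == a].

(* f is a Carmichael polynomial: F[t]/(f) is a Carmichael ring.
   {poly %/ f} is mathcomp's quotient ring F[t]/(f) (valid for f monic of
   degree >= 1, which is the case for all polynomials counted below). *)
Definition carmichael_poly (F : finFieldType) (f : {poly F}) : bool :=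
  carmichael_ring {poly %/ f}.

Definition C_count (F : finFieldType) (n : nat) : nat :=
  #|[set f : {poly_n.+1 F} |
      [&& (val f \is monic), size (val f) == n.+1 & carmichael_poly (val f)]]|.

Definition composite (n : nat) : bool := (1 < n)%N && ~~ prime n.

(* Main.v *)
(** Modulo a Carmichael polynomial [f] of degree [n] every [a] satisfies
    [a ^ (q ^ n) = a]; hence [f] is squarefree and reducible, and each of its
    irreducible factors has a degree [d] dividing [n], with [d < n].  There are
    at most [q ^ d / d] monic irreducibles of degree [d], so for [X = x / q],
    [C_q(n) X^n <= \prod_p (1 + X^(deg p)) <= exp (\sum_(d | n, d < n) x^d / d)].
    Take [x = n^(1/n)].  As [d <= n / 2], convexity of [d |-> x^d] gives
    [x^d / d <= 1 / d + 2 / sqrt n]; since [n] has at most [sqrt n] divisors on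
    either side of [sqrt n], the exponent is at most [ln n / 2 + 6], whence
    [C_q(n) <= e^6 q^n / sqrt n]. *)
Require Import Defs.
From mathcomp Require Import all_boot all_order all_algebra all_field.
From mathcomp Require Import reals sequences exp ring lra.
Set Implicit Arguments. Unset Strict Implicit. Unset Printing Implicit Defensive.
Import Order.TTheory GRing.Theory Num.Theory.
Local Open Scope ring_scope.

(** * Polynomials over a finite field *)

Section Quotient.
Variable F : finFieldType.
Implicit Types f p a g : {poly F}.

Lemma in_qpoly_eq0 f a : (1 < size f)%N -> f \is monic ->
  (in_qpoly f a == 0) = (f %| a).
Proof.
move=> f_gt1 f_mon.
by rewrite -val_eqE /= /mk_monic f_gt1 f_mon /= -Pdiv.IdomainMonic.modpE.
Qed.

(** Fermat's theorem in the field F[t]/(p), which has q^(deg p) elements. *)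
Lemma irreducible_dvdp_expX_card p a : irreducible_poly p -> p \is monic ->
  p %| a ^+ (#|F| ^ (size p).-1) - a.
Proof.
move=> p_irr p_mon; pose hI : monic_irreducible_poly p := (p_irr, p_mon).
rewrite -in_qpoly_eq0 ?p_irr // rmorphB rmorphXn subr_eq0; apply/eqP.
by rewrite -(card_qfpoly hI); exact: (@expf_card {poly %/ p with hI}).
Qed.

(** In K = F[t]/(p), of order q^d, raising to the powers q^n and q^d is the identity, hence so is
    raising to q^r with r = n mod d. If r > 0, then X^(q^r) - X would have q^d > q^r roots in K. *)
Lemma degree_irreducible_dvdn p n : irreducible_poly p -> p \is monic ->
  (forall a, p %| a ^+ (#|F| ^ n) - a) -> ((size p).-1 %| n)%N.
Proof.
move=> p_irr p_mon p_dvd; pose hI : monic_irreducible_poly p := (p_irr, p_mon).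
pose K : finFieldType := {poly %/ p with hI}.
have [p_gt1 _] := p_irr.
set d := (size p).-1; have d_gt0 : (0 < d)%N by rewrite /d -subn1 subn_gt0.
have cardK : #|K| = (#|F| ^ d)%N by rewrite card_qfpoly.
have Kn (x : K) : x ^+ (#|F| ^ n) = x.
  have -> : x = in_qpoly p (val x) :> K.
    by apply: val_inj; exact/esym/in_qpoly_small/size_mk_monic.
  apply/eqP; rewrite -subr_eq0.
  have := p_dvd (val x); rewrite -in_qpoly_eq0 // rmorphB rmorphXn.
  exact.
have Kmod (x : K) : x ^+ (#|F| ^ (n %% d)) = x.
  have Kd k : x ^+ (#|F| ^ (k * d)) = x.
    elim: k => [|k IH]; first by rewrite expr1.
    by rewrite mulSn expnD exprM -cardK expf_card.
  by rewrite -[RHS]Kn {2}(divn_eq n d) expnD exprM Kd.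
have [r0|r_gt0] := posnP (n %% d); first by rewrite /dvdn r0.
have q_gt1 := finNzRing_gt1 F.
have qr_gt1 : (1 < #|F| ^ (n %% d))%N by rewrite -{1}(expn0 #|F|) ltn_exp2l.
have sz : size ('X^(#|F| ^ (n %% d)) - 'X : {poly K}) = (#|F| ^ (n %% d)).+1.
  by rewrite size_polyDl size_polyXn ?size_polyN ?size_polyX.
have := @max_poly_roots K ('X^(#|F| ^ (n %% d)) - 'X) (enum K).
rewrite -size_poly_eq0 sz enum_uniq -cardE cardK => /(_ isT).
have -> : all (root ('X^(#|F| ^ (n %% d)) - 'X)) (enum K).
  by apply/allP=> x _; rewrite rootE !hornerE Kmod subrr.
by move=> /(_ isT isT); rewrite ltnS leq_exp2l // leqNgt ltn_mod d_gt0.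
Qed.

(* Otherwise [p * g] is a nonzero nilpotent modulo [f]. *)
Lemma squarefree_of_dvdp_expX f p g N : (1 < N)%N -> f != 0 -> (1 < size p)%N ->
  (forall a, f %| a ^+ N - a) -> f != p * p * g.
Proof.
move=> N_gt1 f_neq0 p_gt1 f_dvd; apply/eqP=> fE.
have f_dvd_pg : f %| p * g.
  (* (pg)^2 = fg and N >= 2, so f divides (pg)^N as well as (pg)^N - pg. *)
  have f_dvd_sqr : f %| (p * g) ^+ 2 by rewrite fE expr2 mulrACA mulrA dvdp_mulr.
  have f_dvd_exp : f %| (p * g) ^+ N by rewrite -(subnKC N_gt1) exprD dvdp_mulr.
  by rewrite -(dvdpNr f) -(dvdp_addr _ f_dvd_exp).
have pg_neq0 : p * g != 0.
  by apply: contraNneq f_neq0; rewrite fE -mulrA => ->; rewrite mulr0.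
have := dvdp_leq pg_neq0 f_dvd_pg.
rewrite fE -mulrA size_mul //; last by rewrite -size_poly_gt0 ltnW.
have : (0 < size (p * g)%R)%N by rewrite size_poly_gt0.
by case: (size p) p_gt1 => [|[|k]] // _; case: (size _) => // m _;
  rewrite addSn /= addSn ltnNge leq_addl.
Qed.

Lemma monic_irreducible_factorization f : f \is monic ->
  exists2 s : seq {poly F},
    {in s, forall p, irreducible_poly p /\ p \is monic} & f = \prod_(p <- s) p.
Proof.
have [m] := ubnP (size f); elim: m f => // m IH f; rewrite ltnS => f_le f_mon.
have [/irreducibleP f_irr | ] := boolP (irreducibleb f).
  by exists [:: f]; rewrite ?big_seq1 // => p; rewrite inE => /eqP->.
have f_neq0 := monic_neq0 f_mon.
rewrite /irreducibleb negb_and -leqNgt => /orP[f_le1|].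
  exists [::] => //; rewrite big_nil.
  move: f_mon; rewrite (size1_polyC f_le1) monicE lead_coefC => /eqP ->.
  exact: polyC1.
rewrite negb_forall => /existsP[h]; rewrite negb_imply -ltnNge => /andP[h_dvd h_gt1].
have h_neq0 : (h : {poly F}) != 0 by rewrite -size_poly_gt0 ltnW.
have c_neq0 : (lead_coef h)^-1 != 0 by rewrite invr_eq0 lead_coef_eq0.
pose p := (lead_coef h)^-1 *: (h : {poly F}).
have p_mon : p \is monic by rewrite monicE lead_coefZ mulVf // lead_coef_eq0.
have size_p : size p = size h by rewrite size_scale.
(* [irreducibleb] only tests divisors of size below [size f], so [h] is a proper divisor. *)
have size_h_lt : (size h < size f)%N.
  have := size_npoly h; rewrite -ltnS prednK ?size_poly_gt0 //.
have : p %| f by rewrite dvdpZl // dvdpE.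
case/dvdpP=> g fE.
have g_mon : g \is monic by rewrite -(monicMr g p_mon) -fE.
have size_g_lt : (size g < size f)%N.
  rewrite fE size_mul ?monic_neq0 // size_p.
  case: (size h) h_gt1 => [|[|k]] // _; rewrite !addnS /= -addSn leq_addr //.
have [s1 s1P gE] := IH g (leq_trans size_g_lt f_le) g_mon.
have [|s2 s2P pE] := IH p _ p_mon; first by rewrite size_p (leq_trans size_h_lt).
exists (s1 ++ s2); last by rewrite big_cat /= -gE -pE.
by move=> r; rewrite mem_cat => /orP[/s1P|/s2P].
Qed.

Lemma monic_irreducible_coprimep p g : irreducible_poly p -> p \is monic ->
  irreducible_poly g -> g \is monic -> p != g -> coprimep p g.
Proof.
move=> p_irr p_mon g_irr g_mon; rewrite irreducible_poly_coprime //.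
apply: contra => p_dvd; rewrite -eqp_monic //; apply: g_irr => //.
by rewrite gtn_eqF //; case: p_irr.
Qed.

Lemma dvdp_prod_monic_irreducible (s : seq {poly F}) f : uniq s ->
  {in s, forall p, irreducible_poly p /\ p \is monic} ->
  {in s, forall p, p %| f} -> \prod_(p <- s) p %| f.
Proof.
elim: s => [|p s IH] /=; first by rewrite big_nil dvd1p.
case/andP=> p_notin s_uniq sP s_dvd; rewrite big_cons Gauss_dvdp.
  rewrite s_dvd ?mem_head // IH // => g g_in.
    by apply: sP; rewrite inE g_in orbT.
  by apply: s_dvd; rewrite inE g_in orbT.
have [p_irr p_mon] := sP p (mem_head _ _).
rewrite big_seq; apply: (big_ind (fun g => coprimep p g)) => [|g h pg ph|g g_in].
- exact: coprimep1.
- by rewrite coprimepMr pg.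
have [g_irr g_mon] : irreducible_poly g /\ g \is monic.
  by apply: sP; rewrite inE g_in orbT.
by apply: monic_irreducible_coprimep => //; apply: contraNneq p_notin => ->.
Qed.

(** Distinct monic irreducibles are coprime, and those of degree d divide X^(q^d) - X; so does their
    product, and degrees are compared. *)
Lemma monic_irreducible_count (s : seq {poly F}) d : uniq s ->
  {in s, forall p, [/\ irreducible_poly p, p \is monic & size p = d.+1]} ->
  (size s * d <= #|F| ^ d)%N.
Proof.
move=> s_uniq sP; have [->|d_gt0] := posnP d; first by rewrite muln0.
have q_gt1 := finNzRing_gt1 F.
have qd_gt1 : (1 < #|F| ^ d)%N by rewrite -{1}(expn0 #|F|) ltn_exp2l.
have sz : size ('X^(#|F| ^ d) - 'X : {poly F}) = (#|F| ^ d).+1.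
  by rewrite size_polyDl size_polyXn ?size_polyN ?size_polyX.
have : \prod_(p <- s) p %| ('X^(#|F| ^ d) - 'X : {poly F}).
  apply: dvdp_prod_monic_irreducible => // p /sP[p_irr p_mon size_p] //.
  by have := irreducible_dvdp_expX_card 'X p_irr p_mon; rewrite size_p.
move/dvdp_leq; rewrite -size_poly_eq0 sz => /(_ isT).
suff -> : size (\prod_(p <- s) p)%R = (size s * d).+1 by [].
elim: s s_uniq sP => [|p s IH] /=; first by rewrite big_nil size_poly1.
case/andP=> _ s_uniq sP; have [_ p_mon size_p] := sP p (mem_head _ _).
have sP' : {in s, forall p, [/\ irreducible_poly p, p \is monic & size p = d.+1]}.
  by move=> g g_in; apply: sP; rewrite inE g_in orbT.
rewrite big_cons size_monicM ?IH // ?size_p ?mulSn ?addnS //.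
by rewrite -size_poly_gt0 IH.
Qed.

End Quotient.

(** * Carmichael polynomials and their factorizations *)

Section Carmichael.
Variable F : finFieldType.
Implicit Types a : {poly F}.

Lemma carmichael_dvdp (f : {poly F}) a : (1 < size f)%N -> f \is monic ->
  carmichael_poly f -> f %| a ^+ (#|F| ^ (size f).-1) - a.
Proof.
move=> f_gt1 f_mon /andP[_ /forallP fP].
by rewrite -in_qpoly_eq0 // rmorphB rmorphXn subr_eq0 -card_monic_qpoly.
Qed.

Lemma carmichael_reducible (f : {poly F}) : f \is monic -> carmichael_poly f ->
  ~ irreducible_poly f.
Proof.
move=> f_mon /andP[/negP f_nfield _] f_irr; apply: f_nfield.
by apply/forallP=> x; apply/implyP=> x_neq0; apply: (coprimep_unit (f_irr, f_mon)).
Qed.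

(** The candidate prime factors of a Carmichael polynomial of degree n; [size <= n] means degree
    below n. Bounding the degree gives a finite type, so that factorizations become finite sets. *)
Definition proper_irreducibles n : {set {poly_n.+1 F}} :=
  [set p : {poly_n.+1 F} | [&& val p \is monic, irreducibleb (val p),
     ((size (val p)).-1 %| n)%N & (size (val p) <= n)%N]].

(** Squarefreeness makes the list of prime factors a set. A factor of degree n would be [f] itself,
    which is reducible. *)
Lemma carmichael_prod n (f : {poly F}) : (0 < n)%N -> size f = n.+1 ->
  f \is monic -> carmichael_poly f ->
  exists2 T : {set {poly_n.+1 F}}, T \subset proper_irreducibles n
    & f = \prod_(p in T) val p.
Proof.
move=> n_gt0 size_f f_mon f_carm.
have f_gt1 : (1 < size f)%N by rewrite size_f.
have f_neq0 := monic_neq0 f_mon.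
have f_dvd a : f %| a ^+ (#|F| ^ n) - a.
  by have := carmichael_dvdp a f_gt1 f_mon f_carm; rewrite size_f.
have qn_gt1 : (1 < #|F| ^ n)%N.
  by rewrite -{1}(expn0 #|F|) ltn_exp2l // finNzRing_gt1.
have [s sP fE] := monic_irreducible_factorization f_mon.
have dvd_f p : p \in s -> p %| f by move=> p_in; rewrite fE (big_rem p) //= dvdp_mulr.
have s_uniq : uniq s.
  apply: count_mem_uniq => p; have [p_in|/count_memPn //] := boolP (p \in s).
  rewrite (permP (perm_to_rem p_in)) /= eqxx.
  suff /count_memPn -> : p \notin rem p s by [].
  apply/negP=> p_in2; have [[p_gt1 _] _] := sP p p_in.
  have /eqP[] := squarefree_of_dvdp_expX (\prod_(g <- rem p (rem p s)) g)
    qn_gt1 f_neq0 p_gt1 f_dvd.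
  by rewrite fE (big_rem p) //= (big_rem p p_in2) /= mulrA.
have s_size p : p \in s -> (size p <= n)%N.
  move=> p_in; have [p_irr p_mon] := sP p p_in.
  have p_dvd := dvd_f p p_in.
  rewrite -ltnS -size_f ltn_neqAle dvdp_leq // andbT.
  apply/negP=> /eqP size_p; apply: (carmichael_reducible f_mon f_carm).
  suff <- : p = f by [].
  by apply/eqP; rewrite -eqp_monic // -dvdp_size_eqp // size_p.
exists [set p : {poly_n.+1 F} | val p \in s].
  apply/subsetP=> p; rewrite !inE => p_in; have [p_irr p_mon] := sP _ p_in.
  rewrite p_mon s_size // (introT (irreducibleP _)) //= andbT.
  by apply: degree_irreducible_dvdn => // a; apply: dvdp_trans (dvd_f _ p_in) _.
have s_npolyK p : p \in s -> npolyp n.+1 p = p :> {poly F}.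
  by move=> p_in; rewrite npolypK // ltnW // ltnS s_size.
(* The truncation [npolyp] fixes the members of [s], so it is injective there and the list product
   becomes a product over a set. *)
rewrite fE; transitivity (\prod_(p <- s) val (npolyp n.+1 p)).
  by apply: eq_big_seq => p p_in; rewrite /= s_npolyK.
rewrite -(big_map (npolyp n.+1) predT val) big_uniq /=; last first.
  by rewrite map_inj_in_uniq // => p g /s_npolyK{2}<- /s_npolyK{2}<- ->.
apply: eq_bigl => p; rewrite inE; apply/mapP/idP => [[g g_in ->]|p_in].
  by rewrite /= s_npolyK.
by exists (val p) => //; apply: val_inj; rewrite /= s_npolyK.
Qed.

(** Expand the product over subsets T of the candidates. Distinct Carmichael polynomials have
    distinct factor sets, each contributing X^n; all other terms are nonnegative. *)
Lemma C_count_expX_le (R : realFieldType) (X : R) n : 0 <= X -> (0 < n)%N ->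
  (C_count F n)%:R * X ^+ n <=
  \prod_(p in proper_irreducibles n) (1 + X ^+ (size (val p)).-1).
Proof.
move=> X_ge0 n_gt0; set A := proper_irreducibles n.
(* Vanishing outside [A] lets the expansion run over all subsets. *)
pose G (p : {poly_n.+1 F}) := if p \in A then X ^+ (size (val p)).-1 else 0.
have G_ge0 p : 0 <= G p by rewrite /G; case: ifP => // _; exact: exprn_ge0.
have -> : \prod_(p in A) (1 + X ^+ (size (val p)).-1) =
    \sum_(T : {set {poly_n.+1 F}}) \prod_(p in T) G p.
  rewrite big_mkcond /=.
  transitivity (\prod_p (G p + 1)).
    by apply: eq_bigr => p _; rewrite /G; case: ifP => _; rewrite ?add0r // addrC.
  rewrite bigA_distr; apply: eq_bigr => T _.
  by rewrite [RHS]big_mkcond.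
rewrite /C_count; set S := [set f | _].
(* The default [set0] is never reached for [f] in [S]. *)
pose fac (f : {poly_n.+1 F}) : {set {poly_n.+1 F}} :=
  odflt set0 [pick T : {set {poly_n.+1 F}} | (T \subset A)
      && (val f == \prod_(p in T) val p)].
have facP f : f \in S -> fac f \subset A /\ val f = \prod_(p in fac f) val p.
  rewrite inE => /and3P[f_mon /eqP size_f f_carm]; rewrite /fac.
  case: pickP => [T /andP[TA /eqP fE] //|noT].
  have [T TA fE] := carmichael_prod n_gt0 size_f f_mon f_carm.
  by have := noT T; rewrite TA -fE eqxx.
have fac_inj : {in S &, injective fac}.
  move=> f g /facP[_ fE] /facP[_ gE] eq_fg.
  by apply: val_inj; rewrite fE gE eq_fg.
have facX f : f \in S -> \prod_(p in fac f) G p = X ^+ n.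
  move=> f_in; have [facA fE] := facP f f_in.
  move: f_in; rewrite inE => /and3P[_ /eqP size_f _].
  transitivity (X ^+ (\sum_(p in fac f) (size (val p)).-1)).
    rewrite expr_sum; apply: eq_bigr => p p_in.
    by rewrite /G (subsetP facA).
  congr (_ ^+ _); apply: succn_inj; transitivity (size (val f)) => //.
  have fac_neq0 p : p \in fac f -> val p != 0.
    by move=> /(subsetP facA); rewrite inE => /andP[/monic_neq0].
  rewrite [in RHS]fE size_prod // -sum1_card.
  rewrite subSn ?leq_sum // => [|p /fac_neq0]; last by rewrite size_poly_gt0.
  congr _.+1; rewrite -sumnB => [|p /fac_neq0]; last by rewrite size_poly_gt0.
  by apply: eq_bigr => p _; rewrite subn1.
rewrite (bigID (mem (fac @: S))) /=; apply: ler_wpDr.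
  by apply: sumr_ge0 => T _; apply: prodr_ge0.
by rewrite big_imset //= (eq_bigr (fun=> X ^+ n)) ?sumr_const ?mulr_natl.
Qed.

End Carmichael.

(** * The divisor sum *)

(* Convexity of [m |-> w ^+ m]: the slope from 0 is nondecreasing. *)
Lemma exprn_slope_le (R : realFieldType) (w : R) m n : 1 <= w -> (m <= n)%N ->
  n%:R * (w ^+ m - 1) <= m%:R * (w ^+ n - 1).
Proof.
move=> w_ge1 /subnKC <-; elim: (n - m)%N => [|k IH]; first by rewrite addn0.
rewrite addnS -natr1 exprS.
have wm : w ^+ m <= w ^+ (m + k) by rewrite ler_weXn2l // leq_addr.
(* The increment needed when the larger exponent goes from m + k to m + k + 1. *)
have bern : w ^+ m - 1 <= m%:R * (w - 1) * w ^+ (m + k).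
  apply: (@le_trans _ _ (m%:R * (w - 1) * w ^+ m)); last first.
    by apply: ler_wpM2l => //; rewrite mulr_ge0 ?subr_ge0.
  elim: m {IH wm} => [|m IH]; first by rewrite mul0r mul0r subrr.
  rewrite exprS -natr1.
  have wm1 : 1 <= w ^+ m by apply: exprn_ege1.
  have m0 : 0 <= m%:R :> R by [].
  have : 0 <= m%:R * (w - 1) * w ^+ m * (w - 1).
    by rewrite !mulr_ge0 ?subr_ge0 // (le_trans _ wm1).
  have : 0 <= (w - 1) * (w ^+ m * (w - 1)).
    by rewrite !mulr_ge0 ?subr_ge0 // (le_trans _ wm1).
  move: IH; set u := w ^+ m; set M := m%:R; nra.
move: IH bern; set u := w ^+ m; set v := w ^+ (m + k).
set M := m%:R; set N := (m + k)%:R; nra.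
Qed.

(** By induction, from 1/(s+1) <= - ln (1 - 1/(s+1)) = ln (s+1) - ln s. *)
Lemma harmonic_sum_le (R : realType) (s : nat) : (0 < s)%N ->
  \sum_(1 <= d < s.+1) (d%:R)^-1 <= 1 + ln (s%:R : R).
Proof.
elim: s => // s IH _; have [->|s_gt0] := posnP s.
  by rewrite big_nat1 invr1 ln1 addr0.
rewrite big_nat_recr //=; apply: (le_trans (lerD (IH s_gt0) (lexx _))).
rewrite -addrA lerD2l.
have s0 : 0 < s%:R :> R by rewrite ltr0n.
have S0 : 0 < s.+1%:R :> R by rewrite ltr0n.
have : ln (1 + (- s.+1%:R^-1)) <= - s.+1%:R^-1 :> R.
  apply: le_ln1Dx; rewrite ltrN2 invf_lt1 // ltr1n //.
have -> : 1 + (- s.+1%:R^-1) = s%:R / s.+1%:R :> R.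
  by rewrite -natr1; field; rewrite natr1 lt0r_neq0.
rewrite ln_div ?posrE //; set u := s.+1%:R^-1; move: (ln _) (ln _) u => a b u.
lra.
Qed.

(** The map d |-> n/d injects these divisors into [1, s]. *)
Lemma large_divisors_count n s : (n < s.+1 * s.+1)%N ->
  (count (fun d => d %| n) (index_iota s.+1 n) <= s)%N.
Proof.
move=> n_lt; rewrite -size_filter.
set t := filter _ _.
rewrite -(size_map (fun d => n %/ d)%N) -[leqRHS](size_iota 1 s).
have tP d : d \in t -> [/\ (d %| n)%N, (s < d)%N & (d < n)%N].
  by rewrite mem_filter mem_index_iota => /and3P[].
apply: uniq_leq_size => [|k /mapP[d /tP[d_dvd d_gt d_lt] ->]].
  rewrite map_inj_in_uniq ?filter_uniq ?iota_uniq // => d e.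
  move=> /tP[d_dvd d_gt d_lt] /tP[e_dvd e_gt e_lt] eq_de.
  have n_gt0 : (0 < n)%N by apply: leq_trans d_lt.
  have /eqP : (n %/ e * d = n %/ e * e)%N by rewrite -{1}eq_de !divnK.
  by rewrite eqn_pmul2l ?divn_gt0 ?(dvdn_leq n_gt0 e_dvd) ?(leq_trans _ e_gt) // => /eqP.
have d_gt0 : (0 < d)%N by apply: leq_trans d_gt.
rewrite mem_iota add1n divn_gt0 // (ltnW d_lt) ltn_divLR //=.
by apply: leq_trans n_lt _; rewrite leq_mul2l d_gt.
Qed.

(** Writing x as [w ^+ 2] turns x^d into w^(2d) with 2d <= n, so the slope inequality applies with
    integer exponents whatever the parity of n. *)
Lemma proper_divisor_sum_le (R : realType) n (w : R) : (1 < n)%N -> 1 <= w ->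
  w ^+ n = Num.sqrt n%:R ->
  \sum_(1 <= d < n | (d %| n)%N) (w ^+ 2) ^+ d / d%:R <= ln (n%:R : R) / 2 + 6.
Proof.
move=> n_gt1 w_ge1 wn; set r := Num.sqrt _ in wn.
have n0 : 0 < n%:R :> R by rewrite ltr0n ltnW.
have r_gt0 : 0 < r by rewrite sqrtr_gt0.
have rr : r * r = n%:R by rewrite -expr2 sqr_sqrtr // ltW.
have r_ge1 : 1 <= r by rewrite -wn exprn_ege1.
pose s := Num.truncn r.
have s_le : s%:R <= r by rewrite truncn_le // ltW.
have s_gt : r < s.+1%:R by apply: truncnS_gt.
have s_gt0 : (0 < s)%N by rewrite truncn_gt0.
have s_lt : (s < n)%N.
  rewrite -(ltr_nat R); apply: (le_lt_trans s_le).
  rewrite -rr ltr_pMr // lt_neqAle r_ge1 andbT; apply/eqP=> r1.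
  by move: rr; rewrite -r1 mulr1 => /esym/eqP; rewrite pnatr_eq1 gtn_eqF.
(* The slope inequality n (w^(2d) - 1) <= 2d (r - 1) with n = r^2 gives w^(2d) <= 1 + 2d/r. *)
have term_le d : (0 < d)%N -> (d %| n)%N -> (d < n)%N ->
    (w ^+ 2) ^+ d / d%:R <= d%:R^-1 + 2 / r.
  move=> d_gt0 d_dvd d_lt; have d0 : 0 < d%:R :> R by rewrite ltr0n.
  have d2 : (2 * d <= n)%N.
    case/dvdnP: d_dvd d_lt => k ->; rewrite -{1}(mul1n d) ltn_mul2r => /andP[_].
    by rewrite leq_mul2r orbC => ->.
  have := exprn_slope_le w_ge1 d2; rewrite -exprM wn natrM -rr => slope.
  rewrite ler_pdivrMr // mulrDl mulVf ?gt_eqF //.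
  rewrite -(ler_pM2l (mulr_gt0 r_gt0 r_gt0)).
  have -> : r * r * (1 + 2 / r * d%:R) = r * r + 2 * d%:R * r.
    by field; rewrite gt_eqF.
  nra.
rewrite (@big_cat_nat _ _ _ s.+1) //=.
have -> : ln n%:R = ln r + ln r by rewrite -rr lnM.
(* The harmonic sum gives 1 + ln r, and s <= r terms 2/r add at most 2. *)
have small : \sum_(1 <= d < s.+1 | (d %| n)%N) (w ^+ 2) ^+ d / d%:R <= 3 + ln r.
  apply: (@le_trans _ _ (\sum_(1 <= d < s.+1) (d%:R^-1 + 2 / r))).
    rewrite big_mkcond /=; apply: ler_sum_nat => d /andP[d_gt0 d_le].
    case: ifP => [d_dvd|_]; first by rewrite term_le // (leq_ltn_trans _ s_lt).
    by rewrite addr_ge0 ?invr_ge0 // divr_ge0 // ltW.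
  rewrite big_split /= sumr_const_nat subSS subn0.
  apply: (le_trans (lerD (harmonic_sum_le R s_gt0) (lexx _))).
  have : ln s%:R <= ln r :> R by rewrite ler_ln ?posrE ?ltr0n.
  have : 2 / r *+ s <= 2.
    by rewrite -mulr_natr mulrAC ler_pdivrMr // ler_pM2l.
  lra.
(* Now d > r, so each term is at most 3/r, and there are at most s <= r terms. *)
have large : \sum_(s.+1 <= d < n | (d %| n)%N) (w ^+ 2) ^+ d / d%:R <= 3.
  apply: (@le_trans _ _ (\sum_(s.+1 <= d < n | (d %| n)%N) (3 / r))).
    rewrite big_nat_cond [leRHS]big_nat_cond; apply: ler_sum.
    move=> d /andP[/andP[d_gt d_lt] d_dvd].
    have d_gt0 : (0 < d)%N by apply: leq_trans d_gt.
    apply: (le_trans (term_le d _ _ _)) => //.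
    have : d%:R^-1 <= r^-1.
      rewrite lef_pV2 ?posrE ?ltr0n // ltW // (lt_le_trans s_gt) //.
      by rewrite ler_nat.
    lra.
  rewrite big_const_seq iter_addr_0 -[leLHS]mulr_natr mulrAC ler_pdivrMr // ler_pM2l //.
  apply: le_trans s_le; rewrite ler_nat; apply: large_divisors_count.
  rewrite -(ltr_nat R) natrM -rr.
  by apply: ltr_pM => //; exact: ltW.
lra.
Qed.

(** * The counting bound *)

Section Bound.
Variables (R : realType) (F : finFieldType).

(** Group by degree: at most q^d / d irreducibles have degree d, each contributing (x/q)^d. *)
Lemma proper_irreducibles_sum_le n (x : R) : (0 < n)%N -> 0 <= x ->
  \sum_(p in proper_irreducibles F n) (x / #|F|%:R) ^+ (size (val p)).-1 <=
  \sum_(1 <= d < n | (d %| n)%N) x ^+ d / d%:R.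
Proof.
move=> n_gt0 x_ge0; set A := proper_irreducibles F n.
pose deg (p : {poly_n.+1 F}) := (size (val p)).-1.
have AP p : p \in A ->
    [/\ irreducible_poly (val p), val p \is monic, (deg p %| n)%N,
      (0 < deg p)%N & (deg p < n)%N].
  rewrite inE => /and4P[p_mon /irreducibleP p_irr p_dvd p_le].
  have [p_gt1 _] := p_irr; split => //; first by rewrite /deg -subn1 subn_gt0.
  by rewrite /deg prednK // ltnW.
have q0 : 0 < #|F|%:R :> R by rewrite ltr0n; apply/card_gt0P; exists 0.
(* All degrees are below n, so [inord] loses nothing. *)
rewrite (partition_big (fun p => inord (deg p) : 'I_n.+1)
  (fun d => [&& d %| n, 0 < d & d < n]%N)) => [|p /AP[_ _ p_dvd p_gt0 p_lt]]; last first.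
  by rewrite inordK ?p_dvd ?p_gt0 // ltnS ltnW.
have -> : \sum_(1 <= d < n | (d %| n)%N) x ^+ d / d%:R =
    \sum_(d < n.+1 | [&& d %| n, 0 < d & d < n]%N) x ^+ d / d%:R.
  rewrite (big_nat_widenl _ 0) // (big_nat_widen _ _ n.+1) // big_mkord.
  by apply: eq_bigl => d; rewrite andbA.
apply: ler_sum => d /and3P[d_dvd d_gt0 d_lt].
have d0 : 0 < d%:R :> R by rewrite ltr0n.
set B := [pred p | (p \in A) && (inord (deg p) == d)].
have BP p : B p -> [/\ irreducible_poly (val p), val p \is monic & size (val p) = d.+1].
  case/andP=> /AP[p_irr p_mon _ p_gt0 p_lt] /eqP <-; split => //.
  rewrite inordK; last by rewrite ltnS ltnW.
  by rewrite /deg prednK // ltnW //; case: p_irr.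
rewrite (eq_bigr (fun=> (x / #|F|%:R) ^+ d)) => [|p /BP[_ _ ->] //].
rewrite sumr_const -[leLHS]mulr_natl ler_pdivlMr // expr_div_n.
have count_le : (#|B| * d <= #|F| ^ d)%N.
  rewrite cardE -(size_map val); apply: monic_irreducible_count.
    by rewrite map_inj_uniq ?enum_uniq //; exact: val_inj.
  by move=> _ /mapP[p p_in ->]; apply: BP; rewrite mem_enum in p_in.
have qd0 : 0 < (#|F|%:R : R) ^+ d by rewrite exprn_gt0.
rewrite mulrAC mulrA ler_pdivrMr // [leRHS]mulrC.
apply: ler_wpM2r; first exact: exprn_ge0.
by rewrite -natrX -natrM ler_nat.
Qed.

Lemma C_count_sqrt_le : exists2 E : R, 0 < E & forall n, (1 < n)%N ->
  (C_count F n)%:R * Num.sqrt n%:R <= E * (#|F| ^ n)%:R.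
Proof.
exists (expR 6) => [|n n_gt1]; first exact: expR_gt0.
have n_gt0 := ltnW n_gt1.
have n0 : 0 < n%:R :> R by rewrite ltr0n.
have q0 : 0 < #|F|%:R :> R by rewrite ltr0n; apply/card_gt0P; exists 0.
have lnn_ge0 : 0 <= ln (n%:R : R) by rewrite ln_ge0 // ler1n.
set r := Num.sqrt _; have r0 : 0 < r by rewrite sqrtr_gt0.
have rr : r * r = n%:R by rewrite -expr2 sqr_sqrtr // ltW.
have lnr : ln r + ln r = ln n%:R by rewrite -rr lnM.
(* This is n^(1/(2n)), so that X = w^2 / q satisfies X^n = n / q^n. *)
pose w : R := expR (ln r / n%:R).
have w_ge1 : 1 <= w.
  rewrite -expR0 ler_expR divr_ge0 ?ler0n //; lra.
have wn : w ^+ n = r.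
  by rewrite -expRM_natr divfK ?gt_eqF // lnK.
have w2_ge0 : 0 <= w ^+ 2 by rewrite exprn_ge0 // expR_ge0.
have X_ge0 : 0 <= w ^+ 2 / #|F|%:R by rewrite divr_ge0.
have := C_count_expX_le F X_ge0 n_gt0.
rewrite expr_div_n -exprM mulnC exprM wn expr2 rr => count_le.
have : (C_count F n)%:R * (n%:R / #|F|%:R ^+ n) <= expR (ln n%:R / 2 + 6) :> R.
  apply: (le_trans count_le).
  apply: (@le_trans _ _ (expR (\sum_(p in proper_irreducibles F n)
      (w ^+ 2 / #|F|%:R) ^+ (size (val p)).-1))).
    (* Each factor is bounded by 1 + y <= e^y. *)
    rewrite expR_sum; apply: ler_prod => p _.
    by rewrite expR_ge1Dx addr_ge0 ?exprn_ge0.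
  rewrite ler_expR; apply: le_trans (proper_divisor_sum_le n_gt1 w_ge1 wn).
  exact: proper_irreducibles_sum_le.
have -> : ln n%:R / 2 = ln r :> R by lra.
have qn0 : 0 < (#|F|%:R : R) ^+ n by rewrite exprn_gt0.
(* The bound reads C r^2 <= r e^6 q^n, with C the count; one factor r cancels. *)
rewrite expRD lnK // mulrA ler_pdivrMr // -rr natrX => H.
by rewrite -(ler_pM2r r0) -mulrA; apply: (le_trans H); rewrite [r * _]mulrC mulrAC.
Qed.

End Bound.

(* Absorbing the constant into n^eps *)
Local Close Scope ring_scope.
(* These rebind the delimiters %N and %R, hence the late import. *)
From mathcomp Require Import Rstruct.
From Stdlib Require Import Reals.

(* F plays the role of F_q, q = #|F|; every prime power q arises this way and
   C_q(n) depends only on q. *)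
Theorem theorem4p6 (F : finFieldType) (eps : R) :
  (0 < eps)%R -> (eps < 1 / 2)%R ->
  exists c : nat, forall n : nat, composite n -> (c < n)%N ->
    (INR (C_count F n) <=
       INR (expn #|F| n) / Rpower (INR n) (1 / 2 - eps))%R.
Proof.
move=> eps_gt0 _; have [E /RltP E_gt0 count_le] := C_count_sqrt_le R F.
(* Beyond E^(1/eps), n^eps is at least E. *)
have [c c_gt] := INR_unbounded (Rpower E (/ eps)).
exists c => n /andP[n_gt1 _] c_lt.
have n_gt0 : (0 < INR n)%R by apply: lt_0_INR; apply/ssrnat.ltP; exact: ltnW.
have n_ge : (Rpower E (/ eps) <= INR n)%R.
  by apply: Rle_trans (Rlt_le _ _ c_gt) _; apply: le_INR; apply/ssrnat.leP; exact: ltnW.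
have E_le : (E <= Rpower (INR n) eps)%R.
  have -> : E = Rpower (Rpower E (/ eps)) eps.
    by rewrite Rpower_mult Rinv_l ?Rpower_1 //; exact: Rgt_not_eq.
  by apply: Rle_Rpower_l; [exact: Rlt_le | split => //; exact: exp_pos].
have bound : (INR (C_count F n) * sqrt (INR n) <= E * INR (expn #|F| n))%R.
  by apply/RleP; rewrite !INRE RsqrtE; exact: count_le.
have P_gt0 : (0 < Rpower (INR n) (1 / 2 - eps))%R by exact: exp_pos.
have sqrtE : (sqrt (INR n) = Rpower (INR n) (1 / 2 - eps) * Rpower (INR n) eps)%R.
  rewrite -Rpower_plus -Rpower_sqrt //; congr Rpower; field.
(* After clearing denominators, C n^(1/2-eps) E <= C n^(1/2-eps) n^eps = C sqrt n <= E q^n. *)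
apply: (Rmult_le_reg_r (Rpower (INR n) (1 / 2 - eps) * E)).
  exact: Rmult_lt_0_compat.
have -> : (INR (expn #|F| n) / Rpower (INR n) (1 / 2 - eps) *
    (Rpower (INR n) (1 / 2 - eps) * E) = E * INR (expn #|F| n))%R
  by field; exact: Rgt_not_eq.
apply: Rle_trans bound; rewrite sqrtE.
by do 2 (apply: Rmult_le_compat_l; first by [exact: pos_INR | exact: Rlt_le]).
Qed.
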